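(* Let $\mathsf{CLL}_{\rm b}:=\mathsf{ILL}_\bot+\mathsf{DNE}$ and let $A\mapsto A^{\ddagger}$ be the translation of formulas of classical linear logic $\mathsf{CLL}$ into formulas of $\mathsf{ILL}_\bot$ defined in the context. Then for every formula $A$ of $\mathsf{CLL}$: $\vdash_{\mathsf{CLL}}A$ if and only if $\vdash_{\mathsf{CLL}_{\rm b}}A^{\ddagger}$.
   Context: Intuitionistic linear logic $\mathsf{ILL}$ (first order). Formulas are built from atomic formulas, including the constants $1,\top,0$, using $\otimes,\&,\oplus,\multimap$, $\forall x,\exists x$ and $!$. Sequents are $\Gamma\vdash A$ with $\Gamma$ a finite multiset of formulas and exactly one formula on the right. Axioms: $A\vdash A$; $\vdash 1$; $\Gamma\vdash\top$; $\Gamma,0\vdash C$. Rules (premises $\Rightarrow$ conclusion): (cut) $\Gamma\vdash A;\ \Delta,A\vdash C\Rightarrow\Gamma,\Delta\vdash C$; $\Gamma\vdash C\Rightarrow\Gamma,1\vdash C$; $\Gamma\vdash A;\ \Delta\vdash B\Rightarrow\Gamma,\Delta\vdash A\otimes B$; $\Gamma,A,B\vdash C\Rightarrow\Gamma,A\otimes B\vdash C$; $\Gamma,A\vdash B\Rightarrow\Gamma\vdash A\multimap B$; $\Gamma\vdash A;\ \Delta,B\vdash C\Rightarrow\Gamma,\Delta,A\multimap B\vdash C$; $\Gamma\vdash A;\ \Gamma\vdash B\Rightarrow\Gamma\vdash A\& B$; $\Gamma,A\vdash C\Rightarrow\Gamma,A\& B\vdash C$; $\Gamma,B\vdash C\Rightarrow\Gamma,A\&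 B\vdash C$; $\Gamma\vdash A\Rightarrow\Gamma\vdash A\oplus B$; $\Gamma\vdash B\Rightarrow\Gamma\vdash A\oplus B$; $\Gamma,A\vdash C;\ \Gamma,B\vdash C\Rightarrow\Gamma,A\oplus B\vdash C$; $\Gamma\vdash A\Rightarrow\Gamma\vdash\forall xA$; $\Gamma,A[t/x]\vdash C\Rightarrow\Gamma,\forall xA\vdash C$; $\Gamma\vdash A[t/x]\Rightarrow\Gamma\vdash\exists xA$; $\Gamma,A\vdash C\Rightarrow\Gamma,\exists xA\vdash C$ (usual eigenvariable conditions); $\Gamma,!A,!A\vdash C\Rightarrow\Gamma,!A\vdash C$; $\Gamma\vdash C\Rightarrow\Gamma,!A\vdash C$; $!\Gamma\vdash A\Rightarrow\,!\Gamma\vdash\,!A$; $\Gamma,A\vdash C\Rightarrow\Gamma,!A\vdash C$. $\mathsf{ILL}_\bot$ extends $\mathsf{ILL}$ by one more constant $\bot$ (also counted as atomic); its sequents have at most one formula on the right (so $C$ in the rules above may be absent), and it has the additional axiom $\bot\vdash$ and rule $\Gamma\vdash\ \Rightarrow\Gamma\vdash\bot$. Negation is $\neg A:=A\multimap\bot$. $\mathsf{DNE}$ is the axiom schema $\neg\neg A\vdash A$. $\vdash_S A$ means that the sequent $\vdash A$ is derivable in $S$. $\mathsf{CLL}$ is standard first-order classical linear logic, in the language with atomic formulas (including the constants), $\otimes,\&,\oplus,\multimap$, the multiplicative disjunction (''par'') written here $\wp$, the exponentials $!,?$, and $\forall,\exists$. The translation $(\cdot)^\ddagger$: $P^\ddagger:=P$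 ($P$ atomic); $(A\otimes B)^\ddagger:=A^\ddagger\otimes B^\ddagger$; $(A\& B)^\ddagger:=A^\ddagger\& B^\ddagger$; $(A\oplus B)^\ddagger:=A^\ddagger\oplus B^\ddagger$; $(A\multimap B)^\ddagger:=A^\ddagger\multimap B^\ddagger$; $(A\,\wp\,B)^\ddagger:=\neg(\neg A^\ddagger\otimes\neg B^\ddagger)$; $(\forall xA)^\ddagger:=\forall xA^\ddagger$; $(\exists xA)^\ddagger:=\exists xA^\ddagger$; $(!A)^\ddagger:=\,!A^\ddagger$; $(?A)^\ddagger:=\neg\,!\,\neg A^\ddagger$. *)

(* Defs.v *)
From Stdlib Require Import List Permutation.
From Stdlib Require Vector.
Import ListNotations.

Set Implicit Arguments.
Unset Strict Implicit.

Record signature : Type := Signature {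
  fsym : Type;
  fsym_ar : fsym -> nat;
  psym : Type;
  psym_ar : psym -> nat
}.

(* Variables are de Bruijn indices: under a quantifier, index 0 is the bound
   variable.  Formulas are thus taken up to renaming of bound variables. *)
Inductive term (L : signature) : Type :=
| var : nat -> term L
| func : forall f : fsym L, Vector.t (term L) (fsym_ar f) -> term L.
Arguments var {L} n.

(* The constants count as atomic formulas. *)
Inductive atomic (L : signature) : Type :=
| APred : forall p : psym L, Vector.t (term L) (psym_ar p) -> atomic L
| AOne : atomic L
| ATop : atomic L
| AZero : atomic L
| ABot : atomic L.
Arguments AOne {L}.
Arguments ATop {L}.
Arguments AZero {L}.
Arguments ABot {L}.

Definition subst (L : signature) : Type := nat -> term L.

Fixpoint subst_term (L : signature) (s : subst L) (t : term L) : term L :=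
  match t with
  | var n => s n
  | func v => func (Vector.map (subst_term s) v)
  end.

Definition subst_atomic (L : signature) (s : subst L) (P : atomic L) : atomic L :=
  match P with
  | APred v => APred (Vector.map (subst_term s) v)
  | AOne => AOne
  | ATop => ATop
  | AZero => AZero
  | ABot => ABot
  end.

Definition shift (L : signature) : subst L := fun n => var (S n).
Arguments shift {L} n.

Definition scons (L : signature) (t : term L) (s : subst L) : subst L :=
  fun n => match n with 0 => t | S m => s m end.

Definition up (L : signature) (s : subst L) : subst L :=
  scons (var 0) (fun n => subst_term shift (s n)).

(* [inst t] sends the bound variable 0 to [t] and lowers the other indices:
   substituting it in the body A of a quantifier gives A[t/x]. *)
Definition inst (L : signature) (t : term L) : subst L := scons t var.

Inductive iform (L : signature) : Type :=
| IAtom : atomic L -> iform L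
| ITensor : iform L -> iform L -> iform L
| IWith : iform L -> iform L -> iform L
| IPlus : iform L -> iform L -> iform L
| ILolli : iform L -> iform L -> iform L
| IForall : iform L -> iform L
| IExists : iform L -> iform L
| IBang : iform L -> iform L.

Definition INeg (L : signature) (A : iform L) : iform L := ILolli A (IAtom ABot).

Fixpoint isubst (L : signature) (s : subst L) (A : iform L) : iform L :=
  match A with
  | IAtom P => IAtom (subst_atomic s P)
  | ITensor A B => ITensor (isubst s A) (isubst s B)
  | IWith A B => IWith (isubst s A) (isubst s B)
  | IPlus A B => IPlus (isubst s A) (isubst s B)
  | ILolli A B => ILolli (isubst s A) (isubst s B)
  | IForall A => IForall (isubst (up s) A)
  | IExists A => IExists (isubst (up s) A)
  | IBang A => IBang (isubst s A)
  end.

(* [ILL_bot_plus Ax G C]: the sequent G |- C is derivable in ILL_bot extended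
   with the additional axioms [Ax].  Antecedents are multisets, rendered as
   lists with an explicit exchange rule; [None] is the empty succedent.
   Eigenvariable conditions are expressed by shifting the side formulas. *)
Inductive ILL_bot_plus (L : signature)
    (Ax : list (iform L) -> option (iform L) -> Prop) :
    list (iform L) -> option (iform L) -> Prop :=
| I_extra G C : Ax G C -> ILL_bot_plus Ax G C
| I_exch G G' C :
    Permutation G G' -> ILL_bot_plus Ax G C -> ILL_bot_plus Ax G' C
| I_ax A : ILL_bot_plus Ax [A] (Some A)
| I_cut G D A C :
    ILL_bot_plus Ax G (Some A) -> ILL_bot_plus Ax (A :: D) C ->
    ILL_bot_plus Ax (G ++ D) C
| I_oneR : ILL_bot_plus Ax [] (Some (IAtom AOne))
| I_oneL G C : ILL_bot_plus Ax G C -> ILL_bot_plus Ax (IAtom AOne :: G) C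
| I_topR G : ILL_bot_plus Ax G (Some (IAtom ATop))
| I_zeroL G C : ILL_bot_plus Ax (IAtom AZero :: G) C
| I_botL : ILL_bot_plus Ax [IAtom ABot] None
| I_botR G : ILL_bot_plus Ax G None -> ILL_bot_plus Ax G (Some (IAtom ABot))
| I_tensorR G D A B :
    ILL_bot_plus Ax G (Some A) -> ILL_bot_plus Ax D (Some B) ->
    ILL_bot_plus Ax (G ++ D) (Some (ITensor A B))
| I_tensorL G A B C :
    ILL_bot_plus Ax (A :: B :: G) C -> ILL_bot_plus Ax (ITensor A B :: G) C
| I_lolliR G A B :
    ILL_bot_plus Ax (A :: G) (Some B) -> ILL_bot_plus Ax G (Some (ILolli A B))
| I_lolliL G D A B C :
    ILL_bot_plus Ax G (Some A) -> ILL_bot_plus Ax (B :: D) C ->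
    ILL_bot_plus Ax (ILolli A B :: G ++ D) C
| I_withR G A B :
    ILL_bot_plus Ax G (Some A) -> ILL_bot_plus Ax G (Some B) ->
    ILL_bot_plus Ax G (Some (IWith A B))
| I_withL1 G A B C :
    ILL_bot_plus Ax (A :: G) C -> ILL_bot_plus Ax (IWith A B :: G) C
| I_withL2 G A B C :
    ILL_bot_plus Ax (B :: G) C -> ILL_bot_plus Ax (IWith A B :: G) C
| I_plusR1 G A B :
    ILL_bot_plus Ax G (Some A) -> ILL_bot_plus Ax G (Some (IPlus A B))
| I_plusR2 G A B :
    ILL_bot_plus Ax G (Some B) -> ILL_bot_plus Ax G (Some (IPlus A B))
| I_plusL G A B C :
    ILL_bot_plus Ax (A :: G) C -> ILL_bot_plus Ax (B :: G) C ->
    ILL_bot_plus Ax (IPlus A B :: G) C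
| I_forallR G A :
    ILL_bot_plus Ax (map (isubst shift) G) (Some A) ->
    ILL_bot_plus Ax G (Some (IForall A))
| I_forallL G A t C :
    ILL_bot_plus Ax (isubst (inst t) A :: G) C ->
    ILL_bot_plus Ax (IForall A :: G) C
| I_existsR G A t :
    ILL_bot_plus Ax G (Some (isubst (inst t) A)) ->
    ILL_bot_plus Ax G (Some (IExists A))
| I_existsL G A C :
    ILL_bot_plus Ax (A :: map (isubst shift) G) (option_map (isubst shift) C) ->
    ILL_bot_plus Ax (IExists A :: G) C
| I_contr G A C :
    ILL_bot_plus Ax (IBang A :: IBang A :: G) C ->
    ILL_bot_plus Ax (IBang A :: G) C
| I_weak G A C : ILL_bot_plus Ax G C -> ILL_bot_plus Ax (IBang A :: G) C
| I_prom G A :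
    ILL_bot_plus Ax (map (@IBang L) G) (Some A) ->
    ILL_bot_plus Ax (map (@IBang L) G) (Some (IBang A))
| I_der G A C :
    ILL_bot_plus Ax (A :: G) C -> ILL_bot_plus Ax (IBang A :: G) C.

Inductive DNE (L : signature) : list (iform L) -> option (iform L) -> Prop :=
| dne A : DNE [INeg (INeg A)] (Some A).

Definition CLLb (L : signature) : list (iform L) -> option (iform L) -> Prop :=
  ILL_bot_plus (@DNE L).

Inductive cform (L : signature) : Type :=
| CAtom : atomic L -> cform L
| CTensor : cform L -> cform L -> cform L
| CWith : cform L -> cform L -> cform L
| CPlus : cform L -> cform L -> cform L
| CLolli : cform L -> cform L -> cform L
| CPar : cform L -> cform L -> cform L
| CForall : cform L -> cform L
| CExists : cform L -> cform L
| CBang : cform L -> cform L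
| CWhynot : cform L -> cform L.

Fixpoint csubst (L : signature) (s : subst L) (A : cform L) : cform L :=
  match A with
  | CAtom P => CAtom (subst_atomic s P)
  | CTensor A B => CTensor (csubst s A) (csubst s B)
  | CWith A B => CWith (csubst s A) (csubst s B)
  | CPlus A B => CPlus (csubst s A) (csubst s B)
  | CLolli A B => CLolli (csubst s A) (csubst s B)
  | CPar A B => CPar (csubst s A) (csubst s B)
  | CForall A => CForall (csubst (up s) A)
  | CExists A => CExists (csubst (up s) A)
  | CBang A => CBang (csubst s A)
  | CWhynot A => CWhynot (csubst s A)
  end.

(* Two-sided calculus, with the same conventions for multisets and
   eigenvariables as above. *)
Inductive CLL (L : signature) : list (cform L) -> list (cform L) -> Prop :=
| C_exch G G' D D' :
    Permutation G G' -> Permutation D D' -> CLL G D -> CLL G' D'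
| C_ax A : CLL [A] [A]
| C_cut G G' D D' A :
    CLL G (A :: D) -> CLL (A :: G') D' -> CLL (G ++ G') (D ++ D')
| C_oneR : CLL [] [CAtom AOne]
| C_oneL G D : CLL G D -> CLL (CAtom AOne :: G) D
| C_botL : CLL [CAtom ABot] []
| C_botR G D : CLL G D -> CLL G (CAtom ABot :: D)
| C_topR G D : CLL G (CAtom ATop :: D)
| C_zeroL G D : CLL (CAtom AZero :: G) D
| C_tensorR G G' D D' A B :
    CLL G (A :: D) -> CLL G' (B :: D') ->
    CLL (G ++ G') (CTensor A B :: D ++ D')
| C_tensorL G D A B : CLL (A :: B :: G) D -> CLL (CTensor A B :: G) D
| C_parR G D A B : CLL G (A :: B :: D) -> CLL G (CPar A B :: D)
| C_parL G G' D D' A B :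
    CLL (A :: G) D -> CLL (B :: G') D' ->
    CLL (CPar A B :: G ++ G') (D ++ D')
| C_lolliR G D A B : CLL (A :: G) (B :: D) -> CLL G (CLolli A B :: D)
| C_lolliL G G' D D' A B :
    CLL G (A :: D) -> CLL (B :: G') D' ->
    CLL (CLolli A B :: G ++ G') (D ++ D')
| C_withR G D A B :
    CLL G (A :: D) -> CLL G (B :: D) -> CLL G (CWith A B :: D)
| C_withL1 G D A B : CLL (A :: G) D -> CLL (CWith A B :: G) D
| C_withL2 G D A B : CLL (B :: G) D -> CLL (CWith A B :: G) D
| C_plusR1 G D A B : CLL G (A :: D) -> CLL G (CPlus A B :: D)
| C_plusR2 G D A B : CLL G (B :: D) -> CLL G (CPlus A B :: D)
| C_plusL G D A B :
    CLL (A :: G) D -> CLL (B :: G) D -> CLL (CPlus A B :: G) D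
| C_forallR G D A :
    CLL (map (csubst shift) G) (A :: map (csubst shift) D) ->
    CLL G (CForall A :: D)
| C_forallL G D A t :
    CLL (csubst (inst t) A :: G) D -> CLL (CForall A :: G) D
| C_existsR G D A t :
    CLL G (csubst (inst t) A :: D) -> CLL G (CExists A :: D)
| C_existsL G D A :
    CLL (A :: map (csubst shift) G) (map (csubst shift) D) ->
    CLL (CExists A :: G) D
| C_bang_contr G D A :
    CLL (CBang A :: CBang A :: G) D -> CLL (CBang A :: G) D
| C_bang_weak G D A : CLL G D -> CLL (CBang A :: G) D
| C_bang_prom G D A :
    CLL (map (@CBang L) G) (A :: map (@CWhynot L) D) ->
    CLL (map (@CBang L) G) (CBang A :: map (@CWhynot L) D)
| C_bang_der G D A : CLL (A :: G) D -> CLL (CBang A :: G) D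
| C_whynot_contr G D A :
    CLL G (CWhynot A :: CWhynot A :: D) -> CLL G (CWhynot A :: D)
| C_whynot_weak G D A : CLL G D -> CLL G (CWhynot A :: D)
| C_whynot_prom G D A :
    CLL (A :: map (@CBang L) G) (map (@CWhynot L) D) ->
    CLL (CWhynot A :: map (@CBang L) G) (map (@CWhynot L) D)
| C_whynot_der G D A : CLL G (A :: D) -> CLL G (CWhynot A :: D).

Fixpoint ddag (L : signature) (A : cform L) : iform L :=
  match A with
  | CAtom P => IAtom P
  | CTensor A B => ITensor (ddag A) (ddag B)
  | CWith A B => IWith (ddag A) (ddag B)
  | CPlus A B => IPlus (ddag A) (ddag B)
  | CLolli A B => ILolli (ddag A) (ddag B)
  | CPar A B => INeg (ITensor (INeg (ddag A)) (INeg (ddag B)))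
  | CForall A => IForall (ddag A)
  | CExists A => IExists (ddag A)
  | CBang A => IBang (ddag A)
  | CWhynot A => INeg (IBang (INeg (ddag A)))
  end.

(* Main.v *)
Require Import Defs.
From Stdlib Require Import List Permutation.
Import ListNotations.

(** From left to right, a classical sequent [G |- D] becomes the one-sided
    intuitionistic refutation [G‡, ¬D‡ |-]; DNE lets any negated formula be
    moved back to the right, so each classical rule becomes its intuitionistic
    counterpart, and [¬(?A)‡] is interchangeable with [!¬A‡].  From right to
    left, CLLb is a subsystem of CLL when read in the same connectives, and CLL
    proves each [A] equivalent to [A‡]. *)

Set Implicit Arguments.

Definition refuted {L} (A : cform L) : iform L := INeg (ddag A).

Fixpoint emb {L} (A : iform L) : cform L :=
  match A with
  | IAtom P => CAtom P
  | ITensor A B => CTensor (emb A) (emb B)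
  | IWith A B => CWith (emb A) (emb B)
  | IPlus A B => CPlus (emb A) (emb B)
  | ILolli A B => CLolli (emb A) (emb B)
  | IForall A => CForall (emb A)
  | IExists A => CExists (emb A)
  | IBang A => CBang (emb A)
  end.

Definition emb_succ {L} (C : option (iform L)) : list (cform L) :=
  match C with None => [] | Some A => [emb A] end.

(** [CNeg (emb A)] is convertible to [emb (INeg A)], so the rules for [CNeg] apply directly to
    embedded negations. *)
Definition CNeg {L} (A : cform L) : cform L := CLolli A (CAtom ABot).

(** * Commutation of the translations with substitution and the exponential *)

Lemma ddag_csubst L (A : cform L) s : ddag (csubst s A) = isubst s (ddag A).
Proof.
  revert s; induction A; intros s; simpl; unfold INeg; congruence.
Qed.

Lemma emb_isubst L (A : iform L) s : emb (isubst s A) = csubst s (emb A).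
Proof.
  revert s; induction A; intros s; simpl; congruence.
Qed.

Lemma map_ddag_csubst L s (G : list (cform L)) :
  map (@ddag L) (map (csubst s) G) = map (isubst s) (map (@ddag L) G).
Proof. rewrite !map_map; apply map_ext; intros; apply ddag_csubst. Qed.

Lemma map_refuted_csubst L s (G : list (cform L)) :
  map refuted (map (csubst s) G) = map (isubst s) (map refuted G).
Proof.
  rewrite !map_map; apply map_ext; intros; unfold refuted.
  now rewrite ddag_csubst.
Qed.

Lemma map_emb_isubst L s (G : list (iform L)) :
  map emb (map (isubst s) G) = map (csubst s) (map emb G).
Proof. rewrite !map_map; apply map_ext; intros; apply emb_isubst. Qed.

Lemma map_ddag_bang L (G : list (cform L)) :
  map (@ddag L) (map (@CBang L) G) = map (@IBang L) (map (@ddag L) G).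
Proof. now rewrite !map_map. Qed.

Lemma map_emb_bang L (G : list (iform L)) :
  map emb (map (@IBang L) G) = map (@CBang L) (map emb G).
Proof. now rewrite !map_map. Qed.

Lemma Permutation_rotate A (l r s : list A) :
  Permutation l (s ++ r) -> Permutation l (r ++ s).
Proof. intros H; rewrite H; apply Permutation_app_comm. Qed.

Lemma Permutation_rotate_cons A (l r : list A) x :
  Permutation l (r ++ [x]) -> Permutation l (x :: r).
Proof. apply Permutation_rotate with (r := [x]). Qed.

(* The two sides are right-nested concatenations; the right one is rotated
   until its head block is that of the left one. *)
Ltac permute_rec n :=
  lazymatch n with
  | 0 => fail "permute"
  | S ?m =>
    rewrite <- ?app_assoc, ?app_nil_r; simpl;
    first
      [ apply Permutation_refl
      | apply perm_skip; permute_rec m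
      | apply Permutation_app_head; permute_rec m
      | lazymatch goal with
        | |- Permutation ?l (?x :: ?r) => apply Permutation_rotate_cons
        | |- Permutation ?l (?s ++ ?r) => apply Permutation_rotate
        end; permute_rec m ]
  end.

(** The fuel 30 bounds the skips and rotations; without it, rotation would loop on lists with no
    common block. *)
Ltac permute := permute_rec 30.

Ltac exch_exact H := refine (I_exch _ H); permute.

Ltac exch G' := apply I_exch with (G := G'); [permute|].

(** * Negation and double negation in [CLLb] *)

Lemma neg_left L (G : list (iform L)) A :
  CLLb G (Some A) -> CLLb (INeg A :: G) None.
Proof.
  intros H. rewrite <- (app_nil_r G).
  apply I_lolliL; [exact H | apply I_botL].
Qed.

Lemma neg_right L (G : list (iform L)) A :
  CLLb (A :: G) None -> CLLb G (Some (INeg A)).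
Proof. intros H; apply I_lolliR, I_botR, H. Qed.

Lemma reductio L (G : list (iform L)) A :
  CLLb (INeg A :: G) None -> CLLb G (Some A).
Proof.
  intros H. rewrite <- (app_nil_r G).
  apply I_cut with (A := INeg (INeg A)).
  - now apply neg_right.
  - apply I_extra, dne.
Qed.

(** In the encoding of a classical sequent, the first formula on the right sits between the
    translated left side and the other refuted formulas, hence the form with a middle position. *)
Lemma reductio_mid L (G D : list (iform L)) A :
  CLLb (G ++ INeg A :: D) None -> CLLb (G ++ D) (Some A).
Proof.
  intros H; apply reductio. exch_exact H.
Qed.

Lemma neg_left_mid L (G D : list (iform L)) A :
  CLLb (G ++ D) (Some A) -> CLLb (G ++ INeg A :: D) None.
Proof.
  intros H. exch (INeg A :: G ++ D). now apply neg_left.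
Qed.

Lemma double_neg_intro L (A : iform L) : CLLb [A] (Some (INeg (INeg A))).
Proof. apply neg_right, neg_left, I_ax. Qed.

Lemma double_neg_left L (G : list (iform L)) A C :
  CLLb (INeg (INeg A) :: G) C -> CLLb (A :: G) C.
Proof. intros H; exact (I_cut (double_neg_intro A) H). Qed.

Lemma replace_antecedents L X (f g : X -> iform L) (l : list X) G C :
  (forall x, CLLb [f x] (Some (g x))) ->
  CLLb (G ++ map g l) C -> CLLb (G ++ map f l) C.
Proof.
  intros Hfg. revert G. induction l as [|x l IH]; intros G H; [exact H|].
  simpl in *.
  exch ([f x] ++ (G ++ map f l)).
  apply I_cut with (A := g x); [apply Hfg|].
  (* The replaced formula joins the fixed context, which is why [G] is generalized. *)
  apply (IH (g x :: G)). simpl.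
  exch (G ++ g x :: map g l). exact H.
Qed.

(** [refuted (CWhynot A)] is the double negation of [IBang (refuted A)]; the exchange of the two
    makes promotion applicable, since it requires a fully banged antecedent. *)
Lemma refuted_whynot L (D : list (cform L)) G C :
  CLLb (G ++ map refuted (map (@CWhynot L) D)) C <->
  CLLb (G ++ map (@IBang L) (map refuted D)) C.
Proof.
  rewrite !map_map; split; apply replace_antecedents; intros A.
  - apply double_neg_intro.
  - apply I_extra, dne.
Qed.

(** * From [CLL] to [CLLb] *)

Lemma CLL_to_refutation L (G D : list (cform L)) :
  CLL G D -> CLLb (map (@ddag L) G ++ map refuted D) None.
Proof.
  induction 1; simpl in *; rewrite ?map_app in *;
    rewrite ?map_ddag_csubst, ?map_refuted_csubst, ?ddag_csubst in *.
  - refine (I_exch _ IHCLL).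
    apply Permutation_app; now apply Permutation_map.
  - exch [refuted A; ddag A]. apply neg_left, I_ax.
  - exch ((map (@ddag L) G ++ map refuted D) ++ map (@ddag L) G' ++ map refuted D').
    apply I_cut with (A := ddag A); [now apply reductio_mid | exact IHCLL2].
  - apply neg_left, I_oneR.
  - now apply I_oneL.
  - apply I_botL.
  - apply neg_left_mid, I_botR, IHCLL.
  - apply neg_left_mid, I_topR.
  - apply I_zeroL.
  - apply neg_left_mid.
    exch ((map (@ddag L) G ++ map refuted D) ++ map (@ddag L) G' ++ map refuted D').
    apply I_tensorR; now apply reductio_mid.
  - now apply I_tensorL.
  - apply neg_left_mid, neg_right, I_tensorL.
    exch_exact IHCLL.
  (* A translated par on the left is a negated tensor: it suffices to prove the tensor, and each
     premise proves one of its negated factors. *)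
  - apply neg_left.
    exch ((map (@ddag L) G ++ map refuted D) ++ map (@ddag L) G' ++ map refuted D').
    apply I_tensorR; now apply neg_right.
  - apply neg_left_mid, I_lolliR.
    apply (reductio_mid (ddag A :: map (@ddag L) G)), IHCLL.
  - exch (ILolli (ddag A) (ddag B) ::
      (map (@ddag L) G ++ map refuted D) ++ map (@ddag L) G' ++ map refuted D').
    apply I_lolliL; [now apply reductio_mid | exact IHCLL2].
  - apply neg_left_mid, I_withR; now apply reductio_mid.
  - now apply I_withL1.
  - now apply I_withL2.
  - apply neg_left_mid, I_plusR1; now apply reductio_mid.
  - apply neg_left_mid, I_plusR2; now apply reductio_mid.
  - now apply I_plusL.
  - apply neg_left_mid, I_forallR. rewrite map_app. now apply reductio_mid.
  - eapply I_forallL, IHCLL.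
  (* The instance of the body is hidden under [refuted], out of reach of the initial rewriting. *)
  - apply neg_left_mid, I_existsR with (t := t). apply reductio_mid.
    unfold refuted in IHCLL at 1. rewrite ddag_csubst in IHCLL. exact IHCLL.
  - apply I_existsL. rewrite map_app. exact IHCLL.
  - now apply I_contr.
  - now apply I_weak.
  - apply neg_left_mid, refuted_whynot.
    apply reductio_mid, refuted_whynot in IHCLL.
    rewrite map_ddag_bang, <- map_app in *.
    apply I_prom, IHCLL.
  - now apply I_der.
  (* Contraction acts on [IBang (refuted A)]; each of the two copies is then turned into the doubly
     negated formula of the induction hypothesis. *)
  - apply neg_left_mid, neg_right, I_contr.
    change (refuted (CWhynot A)) with (INeg (INeg (IBang (refuted A)))) in IHCLL.
    apply (@double_neg_left _ _ (IBang (refuted A))).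
    exch (IBang (refuted A) :: INeg (INeg (IBang (refuted A))) ::
      map (@ddag L) G ++ map refuted D).
    apply double_neg_left. exch_exact IHCLL.
  - apply neg_left_mid, neg_right, I_weak, IHCLL.
  - apply neg_left, refuted_whynot.
    apply neg_right, refuted_whynot in IHCLL.
    rewrite map_ddag_bang, <- map_app in *.
    apply I_prom, IHCLL.
  - apply neg_left_mid, neg_right, I_der. exch_exact IHCLL.
Qed.

(** * Cancellation of substitutions *)

Lemma subst_term_cancel L (s r : subst L) :
  (forall n, subst_term s (r n) = var n) ->
  forall t, subst_term s (subst_term r t) = t.
Proof.
  (* Terms are nested in vectors, so the generated induction principle says nothing about the
     arguments of a function symbol. *)
  intros H. fix IH 1. intros [n | f v]; simpl; [apply H|].
  f_equal. induction v as [|t k v IHv]; simpl; [reflexivity|].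
  rewrite IH, IHv. reflexivity.
Qed.

(** With [r] a renaming, both hypotheses pass under [up] by mere computation, and no law for
    composing substitutions with [shift] is required. *)
Lemma csubst_cancel L (A : cform L) (s r : subst L) (f : nat -> nat) :
  (forall n, r n = var (f n)) -> (forall n, s (f n) = var n) ->
  csubst s (csubst r A) = A.
Proof.
  revert s r f. induction A; intros s r g Hr Hs; simpl;
    try (f_equal; eauto; fail).
  - f_equal. destruct a; simpl; try reflexivity. f_equal.
    induction t as [|x k v IHv]; simpl; [reflexivity|].
    rewrite IHv, subst_term_cancel; [reflexivity|].
    intros m; rewrite Hr; apply Hs.
  - f_equal. apply IHA with (f := fun n => match n with 0 => 0 | S m => S (g m) end);
      intros [|m]; simpl; try reflexivity; rewrite ?Hr, ?Hs; reflexivity.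
  - f_equal. apply IHA with (f := fun n => match n with 0 => 0 | S m => S (g m) end);
      intros [|m]; simpl; try reflexivity; rewrite ?Hr, ?Hs; reflexivity.
Qed.

(** An eigenvariable rule shifts a quantified side formula; instantiating that formula with the new
    variable must give back its original body. *)
Lemma csubst_inst_up_shift L (A : cform L) :
  csubst (inst (var 0)) (csubst (up shift) A) = A.
Proof.
  apply csubst_cancel with (f := fun n => match n with 0 => 0 | S m => S (S m) end);
    intros [|m]; reflexivity.
Qed.

(** * From [CLLb] to [CLL] *)

Lemma CNeg_left L (G D : list (cform L)) A :
  CLL G (A :: D) -> CLL (CNeg A :: G) D.
Proof.
  intros H. rewrite <- (app_nil_r G), <- (app_nil_r D).
  apply C_lolliL; [exact H | apply C_botL].
Qed.

Lemma CNeg_right L (G D : list (cform L)) A :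
  CLL (A :: G) D -> CLL G (CNeg A :: D).
Proof. intros H; apply C_lolliR, C_botR, H. Qed.

Lemma CLLb_to_CLL L (G : list (iform L)) C :
  CLLb G C -> CLL (map emb G) (emb_succ C).
Proof.
  induction 1; simpl in *; rewrite ?map_app in *;
    rewrite ?map_emb_isubst, ?map_emb_bang, ?emb_isubst in *;
    try (econstructor; eassumption).
  (* The cases left are DNE, exchange, the rules whose right context must be recognized as empty,
     and [I_existsL] with its optional succedent. *)
  - destruct H as [A]; simpl.
    apply CNeg_left, CNeg_right, C_ax.
  - eapply C_exch; [|apply Permutation_refl|exact IHILL_bot_plus].
    now apply Permutation_map.
  - exact (C_cut IHILL_bot_plus1 IHILL_bot_plus2).
  - now apply C_tensorR with (D := []) (D' := []).
  - now apply C_lolliL with (D := []).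
  - apply C_existsL.
    destruct C as [C|]; simpl in *; rewrite ?emb_isubst in *; exact IHILL_bot_plus.
  - now apply C_bang_prom with (D := []).
Qed.

(** Both directions go through one induction because [CLolli] reverses them on its antecedent. Only
    par and [CWhynot] change shape, and there the equivalence is De Morgan duality. *)
Lemma emb_ddag_equiv L (A : cform L) :
  CLL [emb (ddag A)] [A] /\ CLL [A] [emb (ddag A)].
Proof.
  induction A as
    [P | A [] B [] | A [] B [] | A [] B [] | A [] B [] | A [] B []
    | A [] | A [] | A [] | A []]; simpl.
  - split; apply C_ax.
  - split; apply C_tensorL; now apply (@C_tensorR _ [_] [_] [] []).
  - split; apply C_withR; (now apply C_withL1) || now apply C_withL2.
  - split; apply C_plusL; (now apply C_plusR1) || now apply C_plusR2.
  - split; apply C_lolliR;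
      (eapply C_exch; [apply perm_swap | apply Permutation_refl |]);
      now apply (@C_lolliL _ [_] [] [] [_]).
  - split.
    + apply C_parR, CNeg_left.
      apply (@C_tensorR _ [] [] [_] [_]); now apply CNeg_right.
    + apply CNeg_right, C_tensorL, CNeg_left, CNeg_left.
      eapply C_exch; [apply Permutation_refl | apply perm_swap |].
      now apply (@C_parL _ [] [] [_] [_]).
  - split; apply C_forallR; simpl; apply C_forallL with (t := var 0);
      now rewrite csubst_inst_up_shift.
  - split; apply C_existsL; simpl; apply C_existsR with (t := var 0);
      now rewrite csubst_inst_up_shift.
  - split; apply (@C_bang_prom _ [_] []); now apply C_bang_der.
  - split.
    + apply CNeg_left, (@C_bang_prom _ [] [_]), CNeg_right.
      now apply C_whynot_der.
    + apply CNeg_right.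
      eapply C_exch; [apply perm_swap | apply Permutation_refl |].
      apply (@C_whynot_prom _ [_] []).
      eapply C_exch; [apply perm_swap | apply Permutation_refl |].
      now apply C_bang_der, CNeg_left.
Qed.

Theorem proposition2 (L : signature) (A : cform L) :
  CLL [] [A] <-> CLLb [] (Some (ddag A)).
Proof.
  split.
  - intros H; apply reductio. exact (CLL_to_refutation H).
  - intros H. destruct (emb_ddag_equiv A) as [HA _].
    exact (C_cut (CLLb_to_CLL H) HA).
Qed.
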